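(* Let $G$ be a graph. Then equivalence classes of generators of degree $2$ of $I_G$ correspond to partitions $V_1\cup V_2\cup V_3$ of the vertex set of $G$, where there are no edges between $V_1$ and $V_2$. The generator corresponding to such a partition is precisely $$\left[\begin{array}{ccc}1&0&1\\0&1&1\end{array}\right]-\left[\begin{array}{ccc}1&1&1\\0&0&1\end{array}\right],$$ where the three columns correspond to $V_1$, $V_2$ and $V_3$.
   Context: For a graph $G$ with vertex set $[n]=\{1,\dots,n\}$, edge set $E(G)$ and set of isolated vertices $Iso(G)$, $I_G$ is the kernel of the $\mathbb{C}$-algebra homomorphism $$\phi_G:\mathbb{C}[p_{i_1\cdots i_n}\mid i_j\in\{0,1\}]\to \mathbb{C}[t^{(j,k)}_{a,b},\,t^{(l)}_{a}\mid \{j,k\}\in E(G),\ l\in Iso(G),\ a,b\in\{0,1\}],$$ $$p_{i_1\cdots i_n}\mapsto \prod_{\{j,k\}\in E(G)}t^{(j,k)}_{i_j,i_k}\prod_{l\in Iso(G)}t^{(l)}_{i_l};$$ it is a homogeneous toric ideal. A generator of degree $d$ of $I_G$ means a minimal generator: a homogeneous binomial (a difference of two monomials) of degree $d$ in $I_G$ that is not in the ideal generated by the elements of $I_G$ of degree less than $d$. Tableau notation: a difference of two matrices with rows $I_1,\dots,I_d$ and $J_1,\dots,J_d$ stands for the binomial $\prod_{j} p_{I_j}-\prod_{j} p_{J_j}$. A column corresponding to a set of vertices means that the column is repeated for each vertex in that set. Two generators are equivalent if they lie in the same orbit of $\mathbb{C}[p_{i_1\cdots i_n}]$ under the action of $(\mathbb{Z}/2)^n\rtimes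 \mathrm{Aut}(G)$, where $(c_1,\dots,c_n)\in(\mathbb{Z}/2)^n$ sends $p_{i_1\cdots i_n}$ to $p_{j_1\cdots j_n}$ with $j_r=i_r+c_r$ in $\mathbb{Z}/2$, and $\mathrm{Aut}(G)$ permutes the indices according to the permutation of the vertices of $G$. *)

(* Defs.v *)
From mathcomp Require Import all_boot all_order all_algebra all_fingroup.
From mathcomp Require Export reals complex mpoly.

Set Implicit Arguments.
Unset Strict Implicit.
Unset Printing Implicit Defensive.

Local Open Scope ring_scope.

Section Ideals.
Variable A : comNzRingType.

Definition ideal_generated (S : A -> Prop) (x : A) : Prop :=
  exists s : seq (A * A),
    (forall y, y \in s -> S y.2) /\ x = \sum_(y <- s) y.1 * y.2.

End Ideals.

(* Polynomial rings with variables indexed by a finite type [V], encoded as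
   [{mpoly K[#|V|]}] through the enumeration of [V]. *)
Section FinTypeVariables.
Variable K : comNzRingType.

Definition var (V : finType) (v : V) : {mpoly K[#|V|]} := 'X_(enum_rank v).

(* the [K]-algebra homomorphism sending the variable [v] to [h v] *)
Definition subst (V W : finType) (h : V -> {mpoly K[#|W|]})
    (f : {mpoly K[#|V|]}) : {mpoly K[#|W|]} :=
  f \mPo [tuple h (enum_val k) | k < #|V|].

End FinTypeVariables.

Section GraphIdeal.
Variable n : nat.

(* the binary strings i_1 ... i_n indexing the variables p *)
Definition state : finType := {ffun 'I_n -> bool}.

(* the adjacency relation of a graph; symmetry and irreflexivity are
   hypotheses of the theorem *)
Variable e : rel 'I_n.

(* each edge {j, k} is listed once, as (j, k) with j < k *)
Definition edge : finType :=
  {x : 'I_n * 'I_n | (x.1 < x.2)%N && e x.1 x.2}.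

Definition iso_vertex : finType := {l : 'I_n | [forall k, ~~ e l k]}.

(* [inl ((j, k), (a, b))] is t^(j,k)_{a,b} and [inr (l, a)] is t^(l)_a *)
Definition tindex : finType :=
  ((edge * (bool * bool)) + (iso_vertex * bool))%type.

Definition is_aut (s : {perm 'I_n}) : Prop :=
  forall j k, e (s j) (s k) = e j k.

Variable K : comNzRingType.

Notation pring := {mpoly K[#|state|]}.

Definition phi : pring -> {mpoly K[#|tindex|]} :=
  subst (fun i : state =>
    (\prod_(x : edge)
        var K (inl (x, (i (val x).1, i (val x).2)) : tindex))
    * \prod_(l : iso_vertex) var K (inr (l, i (val l)) : tindex)).

Definition in_IG (f : pring) : Prop := phi f = 0.

(* [msize g] is the total degree of [g] plus one (and 0 for [g = 0]), so
   [(msize g <= d)%N] says that [g] has degree less than [d]. *)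
Definition is_generator (d : nat) (f : pring) : Prop :=
  [/\ exists m1 m2 : 'X_{1.. #|state|}, f = 'X_[m1] - 'X_[m2],
      f \is d.-homog,
      in_IG f &
      ~ ideal_generated (fun g : pring => in_IG g /\ (msize g <= d)%N) f].

(* [bool] with [addb] is Z/2 *)
Definition flip_act (c : {ffun 'I_n -> bool}) : pring -> pring :=
  subst (fun i : state => var K ([ffun r => i r (+) c r] : state)).

Definition perm_act (s : {perm 'I_n}) : pring -> pring :=
  subst (fun i : state => var K ([ffun r => i ((s^-1)%g r)] : state)).

(* Every element of (Z/2)^n >| Aut(G) is the product of a vector [c] and an
   automorphism [s]. *)
Definition equiv_poly (f g : pring) : Prop :=
  exists (c : {ffun 'I_n -> bool}) (s : {perm 'I_n}),
    is_aut s /\ g = flip_act c (perm_act s f).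

Definition tableau (I J : seq state) : pring :=
  \prod_(i <- I) var K i - \prod_(j <- J) var K j.

(* The blocks [V1] and [V2] are nonempty: otherwise the binomial below is 0.
   [V3] may be empty. *)
Definition admissible (V1 V2 V3 : {set 'I_n}) : Prop :=
  [/\ V1 :|: V2 :|: V3 = [set: 'I_n],
      [/\ [disjoint V1 & V2], [disjoint V1 & V3] & [disjoint V2 & V3]],
      V1 != set0 /\ V2 != set0 &
      forall j k, j \in V1 -> k \in V2 -> ~~ e j k].

(* The tableaux row with entry [a] in the columns of [V1], [b] in those of
   [V2] and [c] in the remaining ones, which are those of [V3]. *)
Definition row3 (V1 V2 V3 : {set 'I_n}) (a b c : bool) : state :=
  [ffun v => if v \in V1 then a else if v \in V2 then b else c].

Definition partition_binomial (V1 V2 V3 : {set 'I_n}) : pring :=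
  let row := row3 V1 V2 V3 in
  tableau [:: row true  false true;
              row false true  true]
          [:: row true  true  true;
              row false false true].

(* Partitions are taken up to Aut(G), as generators are; the pair {V1, V2} is
   unordered since exchanging V1 and V2 only exchanges the rows of the first
   matrix. *)
Definition equiv_partition (V1 V2 V3 W1 W2 W3 : {set 'I_n}) : Prop :=
  exists s : {perm 'I_n},
    [/\ is_aut s, s @: V3 = W3 &
        (s @: V1 = W1 /\ s @: V2 = W2) \/ (s @: V1 = W2 /\ s @: V2 = W1)].

End GraphIdeal.

(* Main.v *)
Require Import Defs.
From mathcomp Require Import all_boot all_order all_algebra all_fingroup.
From mathcomp Require Import reals complex mpoly.

Set Implicit Arguments.
Unset Strict Implicit.
Unset Printing Implicit Defensive.

Import GRing.Theory.

Local Open Scope ring_scope.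

(** The map [phi] sends monomials to monomials.  Write a monomial of the source
    ring as a list of rows, one row (a 0/1 labelling of the vertices) for each
    factor.  Its image records exactly, for every edge {j, k}, the multiset of
    pairs of entries in the columns j and k, and for every isolated vertex the
    multiset of entries in its column.  So a tableau binomial lies in the ideal
    if and only if its two matrices agree, up to the order of the entries, in
    every column and in every pair of adjacent columns ([in_IG_tableau]).

    When the graph has a vertex, [phi] is injective on polynomials of degree at
    most 1 ([IG_linear_eq0]), because a single row can be read off from its
    image.  Hence every nonzero homogeneous quadratic binomial of the ideal is a
    generator of degree 2, and the question becomes one about matrices with two
    rows.

    Let rows a, b on one side and c, d on the other agree in every column.  The
    vertices split into three blocks: V3, where a and b coincide; V1, where they
    differ and c follows a; V2, where they differ and c follows b.  The binomial
    is nonzero exactly when V1 and V2 are both nonempty.  An edge between V1 and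
    V2 is excluded, since there the pairs of entries in c, d are different from
    those in a, b; all other edges preserve the pairs.  Flipping columns turns a
    into the first row of the normal form and thereby the other three rows into
    theirs ([generator_partition]).

    Conversely the partition is visible in the binomial up to exchanging V1 and
    V2: the relations [two rows agree at v] are unaffected by flips, are
    transported by automorphisms, and determine V3 and the unordered pair of
    blocks V1, V2 ([equiv_partition_binomial]).  The coefficients may be taken
    in any commutative nonzero ring. *)

(** * Monomials as multisets of variables *)

Section Monomials.
Variables (K : comNzRingType) (V : finType).
Implicit Types (s t : seq V) (m : 'X_{1..#|V|}).

Definition content s : 'X_{1..#|V|} :=
  [multinom count_mem (enum_val k) s | k < #|V|].

Definition letters m : seq V :=
  flatten [seq nseq (m (enum_rank v)) v | v : V].

Lemma content_cons v s : content (v :: s) = (U_(enum_rank v) + content s)%MM.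
Proof.
apply/mnmP => k; rewrite mnmDE !mnmE /=; congr (_ + _)%N.
by congr nat_of_bool; apply/eqP/eqP => [->|<-]; rewrite (enum_valK, enum_rankK).
Qed.

Lemma prod_var s : \prod_(v <- s) var K v = 'X_[content s].
Proof.
elim: s => [|v s IHs]; last by rewrite big_cons IHs content_cons mpolyXD.
rewrite big_nil -mpolyX0; congr 'X_[_].
Qed.

Lemma contentE s t : (content s == content t) = perm_eq s t.
Proof.
apply/eqP/idP => [/mnmP eq_st|/seq.permP eq_st].
  apply/allP => v _ /=; move: (eq_st (enum_rank v)).
  by rewrite !mnmE enum_rankK => /eqP.
by apply/mnmP => k; rewrite !mnmE eq_st.
Qed.

Lemma mdeg_content s : mdeg (content s) = size s.
Proof.
elim: s => [|v s IHs]; last by rewrite content_cons mdegD mdeg1 IHs.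
by apply/eqP; rewrite mdeg_eq0; apply/eqP/mnmP => k; rewrite !mnmE.
Qed.

Lemma lettersK : cancel letters content.
Proof.
move=> m; apply/mnmP => k; rewrite mnmE count_flatten sumnE !big_map.
rewrite (bigD1 (enum_val k)) //= count_nseq /= eqxx mul1n enum_valK.
rewrite big1 ?addn0 //.
by move=> v /negPf neq_v; rewrite count_nseq /= neq_v.
Qed.

Lemma size_letters m : size (letters m) = mdeg m.
Proof. by rewrite -mdeg_content lettersK. Qed.

Lemma mpolyX_letters m : 'X_[m] = \prod_(v <- letters m) var K v.
Proof. by rewrite prod_var lettersK. Qed.

End Monomials.

(** * Differences of two monomials *)

Section Binomials.
Variables (K : comNzRingType) (N : nat).
Implicit Types m k : 'X_{1..N}.

Lemma mpolyX_inj m k : 'X_[m] = 'X_[k] :> {mpoly K[N]} -> m = k.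
Proof.
move/(congr1 (mcoeff m)); rewrite !mcoeffX eqxx eq_sym.
by case: eqP => // _ /eqP; rewrite (oner_eq0 K).
Qed.

Lemma msupp_binomial m1 m2 : m1 != m2 ->
  msupp ('X_[m1] - 'X_[m2] : {mpoly K[N]}) =i [:: m1; m2].
Proof.
move=> neq_m m; rewrite mcoeff_msupp mcoeffB !mcoeffX !inE !(eq_sym m).
have [<-|_] := eqVneq m1 m.
  by rewrite (eq_sym m2) (negPf neq_m) subr0 oner_eq0.
by case: (m2 == m); rewrite sub0r ?oppr0 ?oppr_eq0 ?oner_eq0 ?eqxx.
Qed.

(** Comparing supports rather than coefficients makes the statement valid in
    characteristic 2, where a binomial equals its opposite. *)
Lemma binomial_inj m1 m2 k1 k2 : m1 != m2 ->
  'X_[m1] - 'X_[m2] = 'X_[k1] - 'X_[k2] :> {mpoly K[N]} ->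
  (m1 = k1 /\ m2 = k2) \/ (m1 = k2 /\ m2 = k1).
Proof.
move=> neq_m eq_mk; have neq_k : k1 != k2.
  apply: contraNneq neq_m => eq_k; apply/eqP/mpolyX_inj/subr0_eq.
  by rewrite eq_mk eq_k subrr.
have := msupp_binomial neq_m; rewrite eq_mk => eq_supp.
have := msupp_binomial neq_k m1; have := msupp_binomial neq_k m2.
rewrite !eq_supp !inE !eqxx orbT => /esym/orP[]/eqP m2E /esym/orP[]/eqP m1E.
- by case/eqP: neq_m; rewrite m1E m2E.
- by right.
- by left.
- by case/eqP: neq_m; rewrite m1E m2E.
Qed.

End Binomials.

(** * Substitutions of monomials for variables *)

Section Substitutions.
Variables (K : comNzRingType) (V W : finType).
Implicit Types (s t : seq V) (h : V -> {mpoly K[#|W|]}).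

Lemma substB h : {morph subst h : f g / f - g}.
Proof. exact: comp_mpolyB. Qed.

Lemma subst_prod h s : subst h (\prod_(v <- s) var K v) = \prod_(v <- s) h v.
Proof.
rewrite /subst rmorph_prod; apply: eq_bigr => v _ /=.
by rewrite comp_mpolyXU -tnth_nth tnth_mktuple enum_rankK.
Qed.

Lemma subst_monomials (g : V -> seq W) h s :
  (forall v, h v = \prod_(w <- g v) var K w) ->
  subst h (\prod_(v <- s) var K v) = \prod_(w <- flatten (map g s)) var K w.
Proof.
by move=> hE; rewrite subst_prod big_flatten big_map; apply: eq_bigr => v _.
Qed.

(** A substitution that sends the monomials of [f] to distinct monomials lets no
    cancellation happen, so each coefficient of [f] survives in the image. *)
Lemma subst_mon_inj (M : 'X_{1..#|V|} -> 'X_{1..#|W|}) h (f : {mpoly K[#|V|]}) :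
  (forall m, subst h 'X_[m] = 'X_[M m]) -> {in msupp f &, injective M} ->
  subst h f = 0 -> f = 0.
Proof.
move=> hM injM f0; apply/eqP; rewrite -msupp_eq0.
case Df: (msupp f) => [//|m r].
have m_f : m \in msupp f by rewrite Df mem_head.
have /(congr1 (mcoeff (M m))) := f0.
rewrite /subst comp_mpolyEX raddf_sum mcoeff0 (bigD1_seq m) //=.
rewrite [_ \mPo _]hM mcoeffZ mcoeffX eqxx mulr1.
rewrite big_seq_cond big1 => [|k /andP[k_f neq_k]].
  by move/eqP; rewrite addr0 mcoeff_eq0 m_f.
rewrite [_ \mPo _]hM mcoeffZ mcoeffX.
case: eqP => [/injM eq_k|_]; last by rewrite mulr0.
by rewrite eq_k ?eqxx in neq_k.
Qed.

End Substitutions.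

(** * Binomials given by tableaux *)

Section Tableaux.
Variables (K : comNzRingType) (n : nat).
Notation state := (state n).
Implicit Types I J : seq state.

Lemma state_ext (i j : state) : i =1 j -> i = j.
Proof. by move=> eq_ij; apply/ffunP. Qed.

Lemma tableauE I J : tableau K I J = 'X_[content I] - 'X_[content J].
Proof. by rewrite /tableau !prod_var. Qed.

Lemma tableau_eq0 I J : (tableau K I J == 0) = perm_eq I J.
Proof.
rewrite tableauE subr_eq0 -contentE.
by apply/eqP/eqP => [/mpolyX_inj|->].
Qed.

Lemma tableau_inj I J I' J' : ~~ perm_eq I J ->
  tableau K I J = tableau K I' J' ->
  perm_eq I I' && perm_eq J J' || perm_eq I J' && perm_eq J I'.
Proof.
rewrite -!contentE !tableauE => neq_IJ /(binomial_inj neq_IJ).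
by case=> -[-> ->]; rewrite !eqxx ?orbT.
Qed.

Lemma subst_tableau (g : state -> state) I J :
  subst (fun i => var K (g i)) (tableau K I J) = tableau K (map g I) (map g J).
Proof.
by rewrite /tableau substB !subst_prod !big_map.
Qed.

End Tableaux.

(** * The toric ideal of a graph *)

Section ToricIdeal.
Variables (K : comNzRingType) (n : nat) (e : rel 'I_n).
Hypotheses (e_sym : ssrbool.symmetric e) (e_irr : irreflexive e).
Notation state := (state n).
Implicit Types (I J : seq state) (i : state).

(** The factors of the monomial [phi (var K i)]. *)
Definition params i : seq (tindex e) :=
  [seq inl (x, (i (val x).1, i (val x).2)) | x <- index_enum (edge e)]
  ++ [seq inr (l, i (val l)) | l <- index_enum (iso_vertex e)].

Definition all_params I := flatten (map params I).

Lemma phi_prod I :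
  phi e (\prod_(i <- I) var K i) = \prod_(t <- all_params I) var K t.
Proof. by apply: subst_monomials => i; rewrite big_cat !big_map. Qed.

Lemma in_IG_params I J :
  in_IG e (tableau K I J) <-> perm_eq (all_params I) (all_params J).
Proof.
rewrite /in_IG /tableau [phi _ _]substB -!/(phi _ _) !phi_prod.
rewrite -contentE !prod_var.
by split=> [/subr0_eq/mpolyX_inj->|/eqP->]; rewrite ?eqxx ?subrr.
Qed.

Lemma params_uniq i : uniq (params i).
Proof.
rewrite cat_uniq !map_inj_uniq ?index_enum_uniq => [|l l' []|x x' []] //.
by rewrite /= andbT; apply/hasPn => _ /mapP[l _ ->]; apply/mapP => -[].
Qed.

Lemma count_params_edge (x : edge e) uv I :
  count_mem (inl (x, uv)) (all_params I)
    = count_mem uv [seq (i (val x).1, i (val x).2) | i : state <- I].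
Proof.
elim: I => //= i I <-; rewrite count_cat count_uniq_mem ?params_uniq //.
congr (nat_of_bool _ + _)%N; rewrite mem_cat.
rewrite [X in _ || X](_ : _ = false) ?orbF; last by apply/mapP => -[].
apply/mapP/eqP => [[y _ [<- <-]]|<-] //.
by exists x; rewrite ?mem_index_enum.
Qed.

Lemma count_params_iso (l : iso_vertex e) a I :
  count_mem (inr (l, a)) (all_params I)
    = count_mem a [seq i (val l) | i : state <- I].
Proof.
elim: I => //= i I <-; rewrite count_cat count_uniq_mem ?params_uniq //.
congr (nat_of_bool _ + _)%N; rewrite mem_cat.
rewrite [X in X || _](_ : _ = false) /=; last by apply/mapP => -[].
apply/mapP/eqP => [[y _ [<- <-]]|<-] //.
by exists l; rewrite ?mem_index_enum.
Qed.

(** A vertex that is not isolated lies on an edge, whose pairs of entries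
    determine those of its column; so the conditions on isolated vertices
    extend to all vertices.  Exchanging the two components of the pairs removes
    the orientation of the edges. *)
Lemma perm_params I J :
  perm_eq (all_params I) (all_params J) <->
  (forall v, perm_eq [seq i v | i : state <- I] [seq i v | i : state <- J]) /\
  (forall j k, e j k -> perm_eq [seq (i j, i k) | i : state <- I]
                                [seq (i j, i k) | i : state <- J]).
Proof.
split=> [/seq.permP eq_IJ|[eq_v eq_e]]; last first.
  apply/allP => -[[x uv]|[l a]] _ /=.
    rewrite !count_params_edge; case/andP: (valP x) => _ /eq_e/seq.permP eq_x.
    by rewrite eq_x.
  by rewrite !count_params_iso; move/seq.permP: (eq_v (val l)) => ->.
have edgeP j k : e j k -> perm_eq [seq (i j, i k) | i : state <- I]
                                  [seq (i j, i k) | i : state <- J].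
  have lt_edge (j' k' : 'I_n) : (j' < k')%N -> e j' k' ->
      perm_eq [seq (i j', i k') | i : state <- I]
              [seq (i j', i k') | i : state <- J].
    move=> lt_jk e_jk; have jkP: (j' < k')%N && e j' k' by apply/andP.
    apply/allP => uv _ /=; apply/eqP.
    have := eq_IJ (pred1 (inl (Sub (j', k') jkP : edge e, uv))).
    by rewrite !count_params_edge.
  have [lt_jk|lt_kj|/val_inj->] := ltngtP j k; first exact: lt_edge.
    rewrite e_sym => /(lt_edge _ _ lt_kj)/(perm_map (fun p => (p.2, p.1))).
    by rewrite -!map_comp.
  by rewrite e_irr.
split=> // v; have [/existsP[k /edgeP]|isoNv] := boolP [exists k, e v k].
  by move/(perm_map fst); rewrite -!map_comp.
have isoP : [forall k, ~~ e v k] by rewrite -negb_exists.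
apply/allP => a _ /=; apply/eqP.
have := eq_IJ (pred1 (inr (Sub v isoP : iso_vertex e, a))).
by rewrite !count_params_iso.
Qed.

Lemma in_IG_tableau I J :
  in_IG e (tableau K I J) <->
  (forall v, perm_eq [seq i v | i : state <- I] [seq i v | i : state <- J]) /\
  (forall j k, e j k -> perm_eq [seq (i j, i k) | i : state <- I]
                                [seq (i j, i k) | i : state <- J]).
Proof. by rewrite in_IG_params perm_params. Qed.

(** On the graph without vertices [phi] sends the only variable to 1, and that
    variable minus 1 is in the ideal.  With a vertex [v0] at hand, the length of
    its column separates the constant monomial from the variables, and all the
    columns together separate the variables. *)
Lemma IG_linear_eq0 (v0 : 'I_n) (f : {mpoly K[#|state|]}) :
  in_IG e f -> (msize f <= 2)%N -> f = 0.
Proof.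
move=> f_IG le_f2.
apply: (@subst_mon_inj _ _ _ (fun m => content (all_params (letters m)))) f_IG.
  by move=> m; rewrite mpolyX_letters [LHS]phi_prod prod_var.
have size_f m : m \in msupp f -> (size (letters m) <= 1)%N.
  by rewrite size_letters -ltnS => /msize_mdeg_lt/leq_trans->.
move=> m k /size_f + /size_f + /eqP.
rewrite contentE -[m in _ -> m = k]lettersK -[k in _ -> _ = k]lettersK.
case: (letters m) => [|i []] // _; case: (letters k) => [|j []] // _.
- by case/perm_params => /(_ v0)/perm_size.
- by case/perm_params => /(_ v0)/perm_size.
case/perm_params => eq_ij _; congr (content [:: _]); apply: state_ext => v.
by have /perm_small_eq-/(_ isT)[] := eq_ij v.
Qed.


(** By [IG_linear_eq0] the elements of degree less than 2 generate the zero
    ideal, so minimality only asks for a nonzero binomial. *)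
Lemma generator_tableau (v0 : 'I_n) (a b c d : state) :
  in_IG e (tableau K [:: a; b] [:: c; d]) -> ~~ perm_eq [:: a; b] [:: c; d] ->
  is_generator e 2 (tableau K [:: a; b] [:: c; d]).
Proof.
move=> f_IG neq_f; split=> //.
- by rewrite tableauE; do 2 eexists.
- rewrite tableauE; apply/dhomogP => m.
  by rewrite msupp_binomial ?contentE // !inE => /orP[]/eqP->;
    apply: mdeg_content.
case=> s [s_gen f_s]; case/negP: neq_f; rewrite -(tableau_eq0 K) f_s.
rewrite big_seq big1 // => y /s_gen[y_IG le_y].
by rewrite (IG_linear_eq0 v0 y_IG le_y) mulr0.
Qed.

Lemma generator_is_tableau (f : {mpoly K[#|state|]}) :
  is_generator e 2 f ->
  exists a b c d : state,
    [/\ f = tableau K [:: a; b] [:: c; d], in_IG e f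
      & ~~ perm_eq [:: a; b] [:: c; d]].
Proof.
case=> -[m1 [m2 Df]] homf f_IG not_gen.
have neq_m : m1 != m2.
  apply: contra_notN not_gen => /eqP eq_m; exists [::].
  by rewrite Df eq_m subrr big_nil.
have homf_deg : {in msupp f, forall m, mdeg m = 2}.
  by move=> m /(dhomog_mf homf).
have deg2 m : m \in [:: m1; m2] ->
    exists a b, m = content [:: a; b] :> 'X_{1..#|state|}.
  rewrite -(msupp_binomial K neq_m) -Df -{2}[m]lettersK => /homf_deg.
  rewrite -size_letters; case: (letters m) => [|a [|b []]] // _.
  by exists a, b.
have [|a [b m1E]] := deg2 m1; first by rewrite mem_head.
have [|c [d m2E]] := deg2 m2; first by rewrite !inE eqxx orbT.
exists a, b, c, d; split=> //.
  by rewrite tableauE -m1E -m2E.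
by rewrite -contentE -m1E -m2E.
Qed.

End ToricIdeal.

(** * Partitions of the vertex set *)

Section Partitions.
Variables (K : comNzRingType) (n : nat) (e : rel 'I_n).
Hypotheses (e_sym : ssrbool.symmetric e) (e_irr : irreflexive e).
Notation state := (state n).
Implicit Types (V W : {set 'I_n}) (i : state).

(** A form of the partition axioms fit for case analysis at a vertex. *)
Lemma admissible_mem V1 V2 V3 v : admissible e V1 V2 V3 ->
  (v \in V3) = ~~ ((v \in V1) || (v \in V2)) /\ ~~ ((v \in V1) && (v \in V2)).
Proof.
case=> cover [/pred0P dis12 /pred0P dis13 /pred0P dis23] _ _.
have := in_setT v; rewrite -cover !inE.
have := dis12 v; have := dis13 v; have := dis23 v => /=.
by case: (v \in V1); case: (v \in V2); case: (v \in V3).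
Qed.

(** Restricted to a vertex of [V1] and one of [V2], the two matrices have the
    rows 10, 01 and 11, 00. *)
Lemma partition_rows_neq V1 V2 V3 : admissible e V1 V2 V3 ->
  ~~ perm_eq [:: row3 V1 V2 V3 true false true; row3 V1 V2 V3 false true true]
             [:: row3 V1 V2 V3 true true true; row3 V1 V2 V3 false false true].
Proof.
move=> adm; have [_ _ [/set0Pn[v vV1] /set0Pn[w wV2]] _] := adm.
have [_ /negP dis_w] := admissible_mem w adm.
apply/negP => /(perm_map (fun i : state => (i v, i w))) /=.
rewrite !ffunE vV1 wV2 (negPf (_ : w \notin V1)) //.
by apply/negP => wV1; apply: dis_w; rewrite wV1.
Qed.

(** Only an edge between [V1] and [V2] could tell the two matrices apart. *)
Lemma partition_generator V1 V2 V3 : admissible e V1 V2 V3 ->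
  is_generator e 2 (partition_binomial K V1 V2 V3).
Proof.
move=> adm; have [_ _ [/set0Pn[v0 _] _] noe] := adm.
apply: generator_tableau => //; last exact: partition_rows_neq.
apply/in_IG_tableau => //; split=> [v|j k e_jk] /=; rewrite !ffunE.
  by case: (v \in V1); case: (v \in V2).
have no_jk j' k' : e j' k' -> ~~ ((j' \in V1) && (k' \in V2)).
  by apply: contraL => /andP[jV1 kV2]; apply: noe.
have := no_jk k j; rewrite e_sym => /(_ e_jk); have := no_jk j k e_jk.
by case: (j \in V1); case: (j \in V2); case: (k \in V1); case: (k \in V2).
Qed.

Definition act_state (c : {ffun 'I_n -> bool}) (s : {perm 'I_n}) i : state :=
  [ffun r => i ((s^-1)%g r) (+) c r].

Lemma act_stateE c s i v : act_state c s i (s v) = i v (+) c (s v).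
Proof. by rewrite ffunE permK. Qed.

Lemma act_tableau c s (I J : seq state) :
  flip_act c (perm_act s (tableau K I J))
    = tableau K (map (act_state c s) I) (map (act_state c s) J).
Proof.
rewrite [perm_act _ _]subst_tableau [LHS]subst_tableau -!map_comp.
by congr (tableau _ _ _); apply: eq_map => i;
  apply: state_ext => v; rewrite !ffunE.
Qed.

(** The blocks record, where the rows of the first matrix differ, which of them
    the first row of the second matrix follows. *)
Lemma generator_partition (f : {mpoly K[#|state|]}) : is_generator e 2 f ->
  exists V1 V2 V3 : {set 'I_n}, admissible e V1 V2 V3 /\
    equiv_poly e f (partition_binomial K V1 V2 V3).
Proof.
case/generator_is_tableau => a [b [c [d [->]]]].
case/in_IG_tableau => // eq_v eq_e neq.
pose V1 := [set v | (a v != b v) && (c v == a v)].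
pose V2 := [set v | (a v != b v) && (c v != a v)].
pose V3 := [set v | a v == b v].
exists V1, V2, V3; split.
  split.
  - by apply/setP => v; rewrite !inE; case: (a v == b v); case: (c v == a v).
  - by split; rewrite disjoint_subset; apply/subsetP => v; rewrite !inE;
      case: (a v == b v); case: (c v == a v).
  - split; apply: contraNneq neq => /setP Vi0;
      [suff [-> ->] : c = b /\ d = a by rewrite (perm_catC [:: a] [:: b])
      |suff [-> ->] : c = a /\ d = b by []];
      split; apply: state_ext => v; have := Vi0 v; have := eq_v v;
      rewrite !inE /=;
      by case: (a v); case: (b v); case: (c v); case: (d v).
  move=> j k; rewrite !inE => jV1 kV2; apply/negP => /eq_e /=; move: jV1 kV2.
  have := eq_v j; have := eq_v k => /=.
  by case: (a j); case: (b j); case: (c j); case: (d j) => //;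
     case: (a k); case: (b k); case: (c k); case: (d k).
(* the flip carrying [a] to the first row of the normal form *)
exists [ffun v => a v (+) row3 V1 V2 V3 true false true v], 1%g.
split=> [j k|]; first by rewrite !perm1.
rewrite act_tableau /= /partition_binomial.
congr (tableau _ [:: _; _] [:: _; _]); apply: state_ext => v; have := eq_v v;
  rewrite !ffunE !inE invg1 perm1 /=;
  by case: (a v); case: (b v); case: (c v); case: (d v).
Qed.

Lemma partition_binomialC V1 V2 V3 : [disjoint V1 & V2] ->
  partition_binomial K V1 V2 V3 = partition_binomial K V2 V1 V3.
Proof.
move=> dis; have rowC x y z : row3 V1 V2 V3 x y z = row3 V2 V1 V3 y x z.
  apply: state_ext => v; rewrite !ffunE; case: ifP => // vV1.
  by rewrite (disjointFr dis vV1).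
by rewrite /partition_binomial !rowC /tableau !big_cons [X in X - _]mulrCA.
Qed.

Lemma partition_binomial_perm (s : {perm 'I_n}) V1 V2 V3 :
  flip_act [ffun=> false] (perm_act s (partition_binomial K V1 V2 V3))
    = partition_binomial K (s @: V1) (s @: V2) (s @: V3).
Proof.
rewrite act_tableau /=.
have act_row3 x y z : act_state [ffun=> false] s (row3 V1 V2 V3 x y z)
    = row3 (s @: V1) (s @: V2) (s @: V3) x y z.
  apply: state_ext => v; rewrite -[v](permKV s) act_stateE !ffunE addbF.
  by rewrite !mem_imset //; apply: perm_inj.
by rewrite !act_row3.
Qed.

Lemma perm_eq2 (T : eqType) (x y z t : T) :
  perm_eq [:: x; y] [:: z; t] -> (x = z /\ y = t) \/ (x = t /\ y = z).
Proof.
move=> eq_xy; have := perm_mem eq_xy x.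
rewrite !inE eqxx /= => /esym/orP[]/eqP xE.
  by left; move: eq_xy; rewrite xE perm_cons => /perm_small_eq-/(_ isT)[].
right; move: eq_xy; rewrite xE perm_sym (perm_catC [:: z] [:: t]) perm_cons.
by move/perm_small_eq => /(_ isT)[].
Qed.

Lemma imset_permE (s : {perm 'I_n}) V W :
  (forall v, (s v \in W) = (v \in V)) -> s @: V = W.
Proof.
move=> eq_VW; apply/setP => v; rewrite -[v](permKV s) eq_VW.
by rewrite mem_imset //; apply: perm_inj.
Qed.

(* For fixed identifications of the rows, the image of a block is computed at
   each vertex [v] separately: membership of [v] and [s v] in the blocks and the
   flip [c (s v)] are booleans tied by the equalities of entries [r12] and
   [r34]. *)
Ltac pointwise c s mV mW r12 r34 :=
  apply: imset_permE; let v := fresh "v" in intro v;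
  move: (proj2 (mV v)) (proj2 (mW v)) (r12 (s v)) (r34 (s v));
  rewrite !act_stateE !ffunE ?(proj1 (mV v)) ?(proj1 (mW v));
  by do 2!case: (v \in _); do 2!case: (s v \in _);
  case: (c (s v)) => //= _ _ [] // _ _ [] //.

(** From right to left, no flip is required.  From left to right, equality of
    the binomials identifies the two matrices of the first with those of the
    second in some order, and the rows within each matrix in some order; under
    each of these eight identifications [s] maps [V3] to [W3], and [V1], [V2] to
    [W1], [W2] in one of the two orders. *)
Lemma equiv_partition_binomial V1 V2 V3 W1 W2 W3 :
  admissible e V1 V2 V3 -> admissible e W1 W2 W3 ->
  equiv_poly e (partition_binomial K V1 V2 V3) (partition_binomial K W1 W2 W3)
  <-> equiv_partition e V1 V2 V3 W1 W2 W3.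
Proof.
move=> admV admW; split=> [[c [s [s_aut]]]|[s [s_aut sV3 sV12]]]; last first.
  exists [ffun=> false], s; split=> //; rewrite partition_binomial_perm.
  have [_ [dis12 _ _] _ _] := admW.
  by case: sV12 => -[-> ->]; rewrite sV3 // partition_binomialC.
rewrite act_tableau => /(tableau_inj (partition_rows_neq admW)) eq_rows.
have mV v := admissible_mem v admV; have mW v := admissible_mem (s v) admW.
have rowsP (i1 i2 j1 j2 : state) : perm_eq [:: i1; i2] [:: j1; j2] ->
    (forall v, i1 v = j1 v /\ i2 v = j2 v) \/
    (forall v, i1 v = j2 v /\ i2 v = j1 v).
  by case/perm_eq2 => -[-> ->]; [left | right].
suff: s @: V3 = W3 /\
    (s @: V1 = W1 /\ s @: V2 = W2 \/ s @: V1 = W2 /\ s @: V2 = W1).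
  by case=> sV3 sV12; exists s.
case/orP: eq_rows => /andP[/rowsP[] r12 /rowsP[] r34];
  (split; [|first [left; split; pointwise c s mV mW r12 r34
                  | right; split; pointwise c s mV mW r12 r34]]);
  pointwise c s mV mW r12 r34.
Qed.

End Partitions.

Theorem corollary4p9 (R : realType) (n : nat) (e : rel 'I_n)
    (e_sym : ssrbool.symmetric e) (e_irr : irreflexive e) :
  [/\ (forall V1 V2 V3 : {set 'I_n}, admissible e V1 V2 V3 ->
         is_generator e 2 (partition_binomial R[i]%C V1 V2 V3)),
      (forall f : {mpoly R[i]%C[#|state n|]}, is_generator e 2 f ->
         exists V1 V2 V3 : {set 'I_n},
           admissible e V1 V2 V3 /\
           equiv_poly e f (partition_binomial R[i]%C V1 V2 V3)) &
      (forall V1 V2 V3 W1 W2 W3 : {set 'I_n},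
         admissible e V1 V2 V3 -> admissible e W1 W2 W3 ->
         (equiv_poly e (partition_binomial R[i]%C V1 V2 V3)
                       (partition_binomial R[i]%C W1 W2 W3)
          <-> equiv_partition e V1 V2 V3 W1 W2 W3))].
Proof.
split=> [V1 V2 V3|f|V1 V2 V3 W1 W2 W3].
- exact: partition_generator.
- exact: generator_partition.
- exact: equiv_partition_binomial.
Qed.
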